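(* For all integers $s\ge 2$ and $m\ge 1$, the graph $K_{1,s}\times P_{2m+1}$ is antimagic.
   Context: $K_{1,s}$ denotes the star with one center and $s$ leaves, and $P_n$ denotes the path on $n$ vertices. For graphs $G$ and $H$, the direct product $G\times H$ has vertex set $V(G)\times V(H)$, with $(x,y)$ adjacent to $(x',y')$ if and only if $xx'\in E(G)$ and $yy'\in E(H)$. A (possibly disconnected) graph $G$ is antimagic if there is a bijection $f:E(G)\to\{1,2,\dots,|E(G)|\}$ such that the vertex sums $\sum_{e\ni v} f(e)$ are pairwise distinct over all vertices $v$ of $G$. *)

(* Defs.v *)
From mathcomp Require Import all_boot.

Set Implicit Arguments.
Unset Strict Implicit.
Unset Printing Implicit Defensive.

Record sgraph := SGraph {
  vertex :> finType;
  adj : rel vertex;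
  adj_sym : symmetric adj;
  adj_irr : irreflexive adj
}.

Definition edges (G : sgraph) : {set {set G}} :=
  [set [set p.1; p.2] | p : G * G & adj p.1 p.2].

Lemma edgesP (G : sgraph) (A : {set G}) :
  reflect (exists x y : G, adj x y /\ A = [set x; y]) (A \in edges G).
Proof.
apply: (iffP imsetP) => [[[x y] /=]|[x [y [xy ->]]]].
  by rewrite inE /= => xy ->; exists x, y.
by exists (x, y); rewrite ?inE.
Qed.

(* [None] is the center and [Some i] are the leaves. *)
Definition star_adj (s : nat) : rel (option 'I_s) :=
  fun x y => (x == None) != (y == None).

Lemma star_adj_sym s : symmetric (@star_adj s).
Proof. by move=> x y; rewrite /star_adj eq_sym. Qed.

Lemma star_adj_irr s : irreflexive (@star_adj s).
Proof. by move=> x; rewrite /star_adj eqxx. Qed.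

Definition star (s : nat) : sgraph :=
  SGraph (@star_adj_sym s) (@star_adj_irr s).

Definition path_adj (n : nat) : rel 'I_n :=
  fun i j => (i.+1 == j :> nat) || (j.+1 == i :> nat).

Lemma path_adj_sym n : symmetric (@path_adj n).
Proof. by move=> i j; rewrite /path_adj orbC. Qed.

Lemma path_adj_irr n : irreflexive (@path_adj n).
Proof. by move=> i; rewrite /path_adj orbb gtn_eqF. Qed.

Definition path_graph (n : nat) : sgraph :=
  SGraph (@path_adj_sym n) (@path_adj_irr n).

Definition direct_adj (G H : sgraph) : rel (G * H) :=
  fun p q => adj p.1 q.1 && adj p.2 q.2.

Lemma direct_adj_sym G H : symmetric (@direct_adj G H).
Proof. by move=> p q; rewrite /direct_adj adj_sym (adj_sym p.2). Qed.

Lemma direct_adj_irr G H : irreflexive (@direct_adj G H).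
Proof. by move=> p; rewrite /direct_adj adj_irr. Qed.

Definition direct_product (G H : sgraph) : sgraph :=
  SGraph (@direct_adj_sym G H) (@direct_adj_irr G H).

(* [f] restricts to a bijection from the edges of [G] onto {1, ..., |E(G)|};
   its values on sets that are not edges are irrelevant. *)
Definition edge_labeling (G : sgraph) (f : {set G} -> nat) : Prop :=
  [/\ {in edges G &, injective f},
      forall e, e \in edges G -> 1 <= f e <= #|edges G|
    & forall k, 1 <= k <= #|edges G| -> exists2 e, e \in edges G & f e = k].

Definition vertex_sum (G : sgraph) (f : {set G} -> nat) (v : G) : nat :=
  \sum_(e in edges G | v \in e) f e.

Definition antimagic (G : sgraph) : Prop :=
  exists2 f : {set G} -> nat, edge_labeling f & injective (vertex_sum f).

(* Main.v *)
(** A leaf of the star at path level [l] is adjacent exactly to the centers at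
levels [l - 1] and [l + 1].  The labels are cut into consecutive pairs, and a
leaf of degree two at level [l] receives the two labels of one pair of the block
]2sl, 2s(l + 1)]; block 0 is shared by the pendant leaves, at levels 0 and 2m.
The pendant sums are then at most 2s, and the other leaf sums are the distinct
numbers 4(sl + i) + 3, whichever edge takes the larger label of a pair.  That
freedom serves the centers: if every center takes only smaller or only larger
labels, a center at an inner level [c] has sum (4c + 2)s^2 or (4c + 2)s^2 + 2s.
These values are far apart, and even, so they avoid the leaf sums; the four
centers at or next to the ends of the path are tuned by the parities of s and m. *)

Require Import Defs.
From mathcomp Require Import all_boot.
From mathcomp Require Import zify.

Set Implicit Arguments.
Unset Strict Implicit.
Unset Printing Implicit Defensive.

(** * Labelings through a parametrization of the edges *)

(** Surjectivity comes for free: an injective labeling with values in 1, ..., [#|T|] is onto by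
    counting. It lets labels be given on parameters rather than on two-element sets. *)
Lemma antimagic_of_param (G : sgraph) (T : finType) (ed : T -> {set G})
    (lab : T -> nat) :
  injective ed -> edges G = [set ed t | t : T] ->
  injective lab -> (forall t, 1 <= lab t <= #|T|) ->
  injective (fun v : G => \sum_(t | v \in ed t) lab t) -> antimagic G.
Proof.
move=> ed_inj edE lab_inj lab_bnd sum_inj.
have cardE : #|edges G| = #|T| by rewrite edE card_imset.
(* The sum inverts [ed]: it has one term on an edge, and is 0 elsewhere. *)
pose f (e : {set G}) := \sum_(t | ed t == e) lab t.
have fE t : f (ed t) = lab t.
  by rewrite /f (big_pred1 t) // => t'; rewrite (inj_eq ed_inj).
exists f; first split.
- move=> e e'; rewrite edE => /imsetP[t _ ->] /imsetP[t' _ ->].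
  by rewrite !fE => /lab_inj ->.
- by move=> e; rewrite cardE edE => /imsetP[t _ ->]; rewrite fE.
- move=> k; rewrite cardE => k_bnd.
  have lab_lt t : (lab t).-1 < #|T| by have := lab_bnd t; lia.
  pose g t := Ordinal (lab_lt t).
  have g_inj : injective g.
    move=> t t' /(congr1 val) /= eq_lab; apply: lab_inj.
    by have := lab_bnd t; have := lab_bnd t'; lia.
  have k_lt : k.-1 < #|T| by lia.
  have : Ordinal k_lt \in codom g.
    by apply: inj_card_onto => //; rewrite card_ord.
  case/codomP=> t /(congr1 val) /= kE; exists (ed t).
    by rewrite edE imset_f.
  by rewrite fE; have := lab_bnd t; lia.
- apply: eq_inj sum_inj _ => v; rewrite /vertex_sum edE big_imset_cond /=.
    by apply: eq_bigr => t _; rewrite fE.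
  by move=> t t' _ _ /ed_inj.
Qed.

(** * The labeling and its injectivity *)

(* Alternates along the centers of each parity class.  The class of 0 is shifted
   when m is odd and s is even: otherwise for s = 2 and m = 5, 9, 13, ... the
   centers at levels m - 1 and 2m would have equal sums. *)
Definition upper_center (s m c : nat) : bool :=
  if odd c then c %% 4 == 1 else (c %% 4 == 0) (+) (odd m && ~~ odd s).

(* Without the swaps, the centers at levels m - 1 and 2m - 1 have equal sums
   when 4 divides m. *)
Definition pendant_swaps (m : nat) : nat := if 4 %| m then 2 else 0.

(* Whether the edge from leaf [i] at level [l] to the center at level [c] takes
   the larger label of its pair. *)
Definition upper (s m i l c : nat) : bool :=
  if l == 0 then pendant_swaps m <= i
  else if l == 2 * m then i < pendant_swaps m
  else upper_center s m c.

Definition block (m l : nat) : nat := if l == 2 * m then 0 else l.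

Definition label (s m i l c : nat) : nat :=
  (2 * (s * block m l + i)).+1 + upper s m i l c.

Definition path_step (m l c : nat) : bool :=
  [&& l <= 2 * m, c <= 2 * m & (l.+1 == c) || (c.+1 == l)].

(** The two centers seen from level [l] have the same parity and differ by 2, so the test modulo 4
    flips. Hence an inner leaf receives both labels of its pair. *)
Lemma upper_center_step s m l :
  0 < l -> upper_center s m l.+1 = ~~ upper_center s m l.-1.
Proof.
case: l => // l _; rewrite /upper_center /= negbK.
case: ifP => l_odd; first by lia.
by rewrite -addNb; congr (_ (+) _); lia.
Qed.

(** A label is decoded in stages: its parity gives the bit [upper], division by [s] then gives [i]
    and the block, and the bit resolves what remains. *)
Lemma label_inj s m i l c i' l' c' : 0 < m ->
  i < s -> i' < s -> path_step m l c -> path_step m l' c' ->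
  label s m i l c = label s m i' l' c' -> [/\ i = i', l = l' & c = c'].
Proof.
rewrite /label => m_gt0 i_s i'_s /and3P[l_m c_m lc] /and3P[l'_m c'_m lc'] eq_lab.
have eq_u : upper s m i l c = upper s m i' l' c' by lia.
have {eq_lab} eq_si : s * block m l + i = s * block m l' + i' by lia.
have eq_i : i = i'.
  have := congr1 (modn^~ s) eq_si.
  by rewrite ![s * _]mulnC !modnMDl !modn_small.
rewrite -{}eq_i {i' i'_s} in eq_u eq_si *.
have {eq_si} eq_t : block m l = block m l'.
  by move/eqP: eq_si; rewrite eqn_add2r eqn_pmul2l; [move/eqP|lia].
suff [-> ->] : l = l' /\ c = c' by [].
move: eq_u eq_t; rewrite /upper /block.
(* Levels 0 and [2 * m] share block 0, but for the same [i] their bits are complementary. *)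
have [l0|l_gt0] := posnP l; have [l'0|l'_gt0] := posnP l'; try lia.
- by rewrite l0 /=; case: (l' =P 2 * m); case: eqP; lia.
- by rewrite l'0 /=; case: (l =P 2 * m); case: eqP; lia.
case: (l =P 2 * m) => [|ln]; case: (l' =P 2 * m) => [|l'n]; try lia.
move=> eq_u eq_l; split=> //; rewrite -{}eq_l in lc' eq_u l'n l'_gt0 *.
(* At an inner level the two possible centers have opposite bits. *)
have uE := upper_center_step s m l_gt0; move: eq_u.
have [->|->] : c = l.+1 \/ c = l.-1 by lia.
  have [-> //|->] : c' = l.+1 \/ c' = l.-1 by lia.
  by rewrite uE; case: upper_center.
have [->|-> //] : c' = l.+1 \/ c' = l.-1 by lia.
by rewrite uE; case: upper_center.
Qed.

Lemma label_bound s m i l c :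
  0 < m -> i < s -> l <= 2 * m -> 1 <= label s m i l c <= 4 * m * s.
Proof.
move=> m_gt0 i_s l_m; rewrite /label /block.
have := leq_b1 (upper s m i l c).
by case: (l =P 2 * m); nia.
Qed.

(** * Leaf and center sums in closed form *)

Definition leaf_sum (s m i l : nat) : nat :=
  (if l < 2 * m then label s m i l l.+1 else 0)
  + (if 0 < l then label s m i l l.-1 else 0).

Definition center_sum (s m c : nat) : nat :=
  (if c < 2 * m then \sum_(i < s) label s m i c.+1 c else 0)
  + (if 0 < c then \sum_(i < s) label s m i c.-1 c else 0).

Lemma sum_odd_shift a n : \sum_(i < n) (2 * (a + i)).+1 = 2 * a * n + n ^ 2.
Proof.
by elim: n => [|n IHn]; rewrite ?big_ord0 ?big_ord_recr /= ?IHn ?muln0 //; lia.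
Qed.

Lemma sum_geq q n : \sum_(i < n) (q <= i) = n - q.
Proof.
by elim: n => [|n IHn]; rewrite ?big_ord0 ?big_ord_recr /= ?IHn //; lia.
Qed.

Lemma sum_ltn q n : q <= n -> \sum_(i < n) (i < q) = q.
Proof.
move=> q_n; have := sum_geq q n.
have : \sum_(i < n) (i < q) + \sum_(i < n) (q <= i) = n.
  rewrite -big_split /= (eq_bigr (fun=> 1)) ?sum1_card ?card_ord //.
  by move=> i _; lia.
by lia.
Qed.

(** The first summand adds up the smaller labels of the block; the second counts the edges that take
    the larger one. As [pendant_swaps m <= 2 <= s], the subtraction is exact. *)
Lemma sum_label s m l c : 2 <= s -> 0 < m ->
  \sum_(i < s) label s m i l c = s ^ 2 * (2 * block m l).+1 +
    (if l == 0 then s - pendant_swaps m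
     else if l == 2 * m then pendant_swaps m else s * upper_center s m c).
Proof.
move=> s_ge2 m_gt0; rewrite /label big_split /= sum_odd_shift; congr (_ + _).
  by rewrite mulnS; lia.
rewrite /upper; case: ifP => _; first exact: sum_geq.
case: ifP => _; last by rewrite sum_nat_const card_ord.
by apply: sum_ltn; rewrite /pendant_swaps; case: ifP; lia.
Qed.

Lemma leaf_sum_first s m i :
  0 < m -> leaf_sum s m i 0 = (2 * i).+1 + (pendant_swaps m <= i).
Proof.
move=> m_gt0; rewrite /leaf_sum /label /upper /block muln_gt0 m_gt0 /=.
by case: eqP; rewrite muln0 !addn0.
Qed.

Lemma leaf_sum_last s m i :
  0 < m -> leaf_sum s m i (2 * m) = (2 * i).+1 + (i < pendant_swaps m).
Proof.
move=> m_gt0; rewrite /leaf_sum /label /upper /block ltnn muln_gt0 m_gt0 /=.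
by rewrite eqxx muln_eq0 (gtn_eqF m_gt0) muln0.
Qed.

Lemma leaf_sum_inner s m i l : 0 < l < 2 * m -> i < s ->
  leaf_sum s m i l = 4 * (s * l + i) + 3.
Proof.
case/andP=> l_gt0 l_lt i_s; rewrite /leaf_sum l_gt0 l_lt /label /upper /block.
rewrite (gtn_eqF l_gt0) (ltn_eqF l_lt) upper_center_step //.
by case: upper_center => /=; lia.
Qed.


Lemma leaf_sum_inj s m i l i' l' : 0 < m -> i < s -> i' < s ->
  l <= 2 * m -> l' <= 2 * m ->
  leaf_sum s m i l = leaf_sum s m i' l' -> i = i' /\ l = l'.
Proof.
move=> m_gt0 i_s i'_s l_m l'_m.
have small j k : j < s -> k \in [:: 0; 2 * m] -> leaf_sum s m j k <= 2 * s.
  move=> j_s; rewrite !inE => /orP[] /eqP ->.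
    by rewrite leaf_sum_first //; lia.
  by rewrite leaf_sum_last //; lia.
have [lE|l_in] : l \in [:: 0; 2 * m] \/ 0 < l < 2 * m by rewrite !inE; lia.
  have [l'E|l'_in] : l' \in [:: 0; 2 * m] \/ 0 < l' < 2 * m.
  - by rewrite !inE; lia.
  - move: lE l'E; rewrite !inE => /orP[] /eqP-> /orP[] /eqP->;
    by rewrite ?leaf_sum_first ?leaf_sum_last //; lia.
  - by have := small _ _ i_s lE; rewrite (leaf_sum_inner l'_in) //; nia.
have [l'E|l'_in] : l' \in [:: 0; 2 * m] \/ 0 < l' < 2 * m.
- by rewrite !inE; lia.
- by have := small _ _ i'_s l'E; rewrite (leaf_sum_inner l_in) //; nia.
rewrite !leaf_sum_inner // => eq_sum.
have {eq_sum} eq_si : s * l + i = s * l' + i' by lia.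
have eq_i : i = i'.
  have := congr1 (modn^~ s) eq_si.
  by rewrite ![s * _]mulnC !modnMDl !modn_small.
by split=> //; nia.
Qed.

Lemma center_sum_first s m : 2 <= s -> 0 < m ->
  center_sum s m 0 = 3 * s ^ 2 + s * ~~ (odd m && ~~ odd s).
Proof.
move=> s_ge2 m_gt0; rewrite /center_sum muln_gt0 m_gt0 /= addn0 sum_label //.
rewrite /block /=; have -> : (1 == 2 * m) = false by lia.
by rewrite mulnC.
Qed.

Lemma center_sum_last s m : 2 <= s -> 0 < m ->
  center_sum s m (2 * m) = (4 * m).-1 * s ^ 2 + s * (~~ odd m || ~~ odd s).
Proof.
move=> s_ge2 m_gt0; rewrite /center_sum ltnn muln_gt0 m_gt0 /= add0n sum_label //.
rewrite /block; have -> : ((2 * m).-1 == 2 * m) = false by lia.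
have -> : ((2 * m).-1 == 0) = false by lia.
congr (_ + _); first by rewrite mulnC; congr (_ * _); lia.
congr (_ * nat_of_bool _); rewrite /upper_center oddM /=.
by case: (boolP (odd m)) => m_odd; case: (odd s) => /=; lia.
Qed.

(** Both neighboring levels are pendant, so each label from 1 to [2 * s] occurs once. *)
Lemma center_sum_unique s : 2 <= s -> center_sum s 1 1 = 2 * s ^ 2 + s.
Proof.
move=> s_ge2; rewrite /center_sum /= !sum_label //.
by rewrite /block /pendant_swaps /=; lia.
Qed.

Lemma center_sum_second s m : 2 <= s -> 2 <= m ->
  center_sum s m 1 = 6 * s ^ 2 + 2 * s - pendant_swaps m.
Proof.
move=> s_ge2 m_ge2; have m_gt0 : 0 < m by lia.
rewrite /center_sum (_ : 1 < 2 * m) /=; last by lia.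
rewrite !sum_label //= /block.
have -> : (2 == 2 * m) = false by lia.
have -> : (0 == 2 * m) = false by lia.
have : pendant_swaps m <= 2 by rewrite /pendant_swaps; case: ifP.
by rewrite /upper_center /=; lia.
Qed.

Lemma center_sum_penultimate s m : 2 <= s -> 2 <= m ->
  center_sum s m (2 * m).-1 =
    (4 * m - 2) * s ^ 2 + s * odd m + pendant_swaps m.
Proof.
move=> s_ge2 m_ge2; have m_gt0 : 0 < m by lia.
rewrite /center_sum.
have -> : (2 * m).-1 < 2 * m by lia.
have -> : 0 < (2 * m).-1 by lia.
rewrite prednK ?muln_gt0 ?m_gt0 // !sum_label // /block eqxx.
have -> : (2 * m == 0) = false by lia.
have -> : ((2 * m).-1.-1 == 2 * m) = false by lia.
have -> : ((2 * m).-1.-1 == 0) = false by lia.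
have -> : upper_center s m (2 * m).-1 = odd m.
  have c_odd : odd (2 * m).-1 by lia.
  by rewrite /upper_center c_odd; lia.
have -> : 4 * m - 2 = 1 + (2 * (2 * m).-1.-1).+1 by lia.
by rewrite mulnDl; lia.
Qed.

Lemma center_sum_inner s m c : 2 <= s -> 1 < c < (2 * m).-1 ->
  center_sum s m c = (4 * c + 2) * s ^ 2 + 2 * s * upper_center s m c.
Proof.
move=> s_ge2 /andP[c_gt1 c_lt]; have m_gt0 : 0 < m by lia.
rewrite /center_sum.
have -> : c < 2 * m by lia.
have -> : 0 < c by lia.
rewrite !sum_label // /block /=.
have -> : (c.+1 == 2 * m) = false by lia.
have -> : (c.-1 == 2 * m) = false by lia.
have -> : (c.-1 == 0) = false by lia.
have -> : 4 * c + 2 = (2 * c.+1).+1 + (2 * c.-1).+1 by lia.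
by rewrite mulnDl; lia.
Qed.

(** * Distinctness of the center sums *)

Lemma center_sum_inner_bounds s m c : 2 <= s -> 1 < c < (2 * m).-1 ->
  (4 * c + 2) * s ^ 2 <= center_sum s m c <= (4 * c + 2) * s ^ 2 + 2 * s.
Proof.
by move=> s_ge2 c_in; rewrite center_sum_inner //; case: upper_center; lia.
Qed.

(** The middle sum is the smallest; the end centers share the term [3 * s ^ 2], and the parity of
    [s] decides which one has the extra [s]. *)
Lemma center_sum_neq_short s c c' : 2 <= s -> c < c' <= 2 ->
  center_sum s 1 c <> center_sum s 1 c'.
Proof.
move=> s_ge2 /andP[lt_c c'_le].
have sq_ge : 2 * s <= s ^ 2 by rewrite leq_mul2r s_ge2 orbT.
have c0 := center_sum_first s_ge2 (leqnn 1).
have c1 := center_sum_unique s_ge2.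
have c2 := center_sum_last s_ge2 (leqnn 1); rewrite /= in c0 c1 c2.
case: c' c lt_c c'_le => [|[|[|]]] // [|[|]] // _ _; rewrite ?c0 ?c1 ?c2;
  by case: (odd s) => /=; lia.
Qed.

Lemma center_sum_neq_long s m c c' : 2 <= s -> 2 <= m -> c < c' <= 2 * m ->
  center_sum s m c <> center_sum s m c'.
Proof.
move=> s_ge2 m_ge2 /andP[lt_c c'_le].
have m_gt0 : 0 < m by lia.
have q_le : pendant_swaps m <= 2 by rewrite /pendant_swaps; case: ifP.
have := center_sum_first s_ge2 m_gt0.
have := center_sum_second s_ge2 m_ge2.
have := center_sum_penultimate s_ge2 m_ge2.
have := center_sum_last s_ge2 m_gt0.
have := center_sum_inner_bounds (m := m) s_ge2.
have := center_sum_inner (m := m) s_ge2.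
have sq_ge : 2 * s <= s ^ 2 by rewrite leq_mul2r s_ge2 orbT.
(* A gap of one [s ^ 2] must beat an excess of up to [2 * s]. It does not when [s = 2]; there the
   last center takes the larger labels, and its extra [s] separates the sums. *)
have sq_ge3 : s = 2 \/ 3 * s <= s ^ 2.
  by case: (ltngtP s 2) => [|s_gt2|]; [lia|right; rewrite leq_mul2r s_gt2 orbT|left].
have mono a b : a <= b -> a * s ^ 2 <= b * s ^ 2.
  by move=> le_ab; rewrite leq_mul2r le_ab orbT.
(* With the square opaque, [mono] compares its multiples and the rest is linear. *)
move: (s ^ 2) sq_ge sq_ge3 mono => Q sq_ge sq_ge3 mono.
move=> cI cB cL cP c1 c0.
have c0_le : center_sum s m 0 <= 3 * Q + s by rewrite c0; case: (~~ _); lia.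
have [E | [E | [c'_in | E]]] :
  c' = 2 * m \/ (c' = (2 * m).-1 \/ (1 < c' < (2 * m).-1 \/ c' = 1)) by lia.
- rewrite {c'}E cL in lt_c c'_le *.
  have last_ge := mono 7 (4 * m).-1 ltac:(lia).
  have [E | [E | [c_in | E]]] :
    c = 0 \/ (c = 1 \/ (1 < c < (2 * m).-1 \/ c = (2 * m).-1)) by lia.
  + by rewrite E; lia.
  + rewrite E c1; case: sq_ge3 => [s2|]; last by lia.
    by rewrite s2 /= orbT; lia.
  + have := cB c c_in; have [c_lt | c_ge] := ltnP c m.
      have /mono : 4 * c + 2 <= (4 * m).-1.-1 by clear - c_lt; lia.
      have -> : (4 * m).-1 = (4 * m).-1.-1.+1 by lia.
      rewrite mulSn; case: sq_ge3 => [s2|]; last by lia.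
      by rewrite s2 /= orbT; lia.
    have /mono : (4 * m).-1 + 1 <= 4 * c + 2 by clear - c_ge; lia.
    by rewrite mulnDl; case: (~~ _ || _); lia.
  + rewrite E cP.
    have -> : (4 * m).-1 = (4 * m - 2).+1 by lia.
    rewrite mulSn /pendant_swaps.
    case: (boolP (odd m)) => m_odd; case: ifP => dvd_m /=; rewrite ?muln1 ?muln0.
    + by lia.
    + by case: (~~ odd s); rewrite ?muln1 ?muln0; lia.
    + by lia.
    + by lia.
- rewrite {c'}E cP in lt_c c'_le *.
  have last_ge := mono 6 (4 * m - 2) ltac:(lia).
  have [E | [E | c_in]] : c = 0 \/ (c = 1 \/ 1 < c < (2 * m).-1) by lia.
  + by rewrite E; lia.
  + rewrite E c1; have [m2|m_gt2] : m = 2 \/ 2 < m by lia.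
      by rewrite m2 /pendant_swaps /=; lia.
    by have := mono 10 (4 * m - 2) ltac:(lia); lia.
  (* Only the center [m.-1] has the same multiple of [Q] as the penultimate one. The remainders are
     0 or [2 * s] against [s] for odd [m], [2 * s] against 0 when [m] is 2 modulo 4, and 0 against 2
     when 4 divides [m]. *)
  + have [c_lt | c_gt | cE] := ltngtP c m.-1; last first.
    * rewrite cI // cE.
      have -> : 4 * m.-1 + 2 = 4 * m - 2 by lia.
      rewrite /upper_center /pendant_swaps.
      case: (boolP (odd m)) => m_odd.
        have -> : (4 %| m) = false by lia.
        by case: (if _ then _ else _); lia.
      have -> : odd m.-1 by lia.
      by case: ifP => dvd_m; case: eqP; lia.
    * have := cB c c_in.
      have := mono (4 * m - 2 + 4) (4 * c + 2) ltac:(lia).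
      by rewrite mulnDl; case: (odd m); lia.
    * have := cB c c_in.
      have := mono (4 * c + 2 + 4) (4 * m - 2) ltac:(lia).
      by rewrite mulnDl; case: (odd m); lia.
- have := cB c' c'_in.
  have inner_ge := mono 10 (4 * c' + 2) ltac:(lia).
  have [E | [E | c_in]] : c = 0 \/ (c = 1 \/ 1 < c < (2 * m).-1) by lia.
  + by rewrite E; lia.
  + by rewrite E c1; lia.
  + have := cB c c_in.
    have := mono (4 * c + 2 + 4) (4 * c' + 2) ltac:(lia).
    by rewrite mulnDl; lia.
- have -> : c = 0 by lia.
  by rewrite E c1; lia.
Qed.

Lemma center_sum_inj s m c c' : 2 <= s -> 0 < m -> c <= 2 * m -> c' <= 2 * m ->
  center_sum s m c = center_sum s m c' -> c = c'.
Proof.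
move=> s_ge2 m_gt0 c_m c'_m.
have neq k k' : k < k' <= 2 * m -> center_sum s m k <> center_sum s m k'.
  have [->|m_ge2] : m = 1 \/ 2 <= m by lia.
    exact: center_sum_neq_short.
  exact: center_sum_neq_long.
by case: (ltngtP c c') => // lt_c eq_sum; [case: (@neq c c')|case: (@neq c' c)];
  rewrite ?lt_c ?c_m ?c'_m.
Qed.

(** * Leaf sums against center sums *)

(** Either alternative excludes an inner leaf sum, which is 3 modulo 4 and below [8 * m * s]. An odd
    center sum needs [s] odd, hence [3 * s <= s ^ 2], which usually makes it large. *)
Lemma center_sum_odd s m c : 2 <= s -> 0 < m -> c <= 2 * m ->
  odd (center_sum s m c) ->
  center_sum s m c %% 4 = 1 \/ 8 * m * s <= center_sum s m c.
Proof.
move=> s_ge2 m_gt0 c_m.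
have sq_odd : odd (s ^ 2) = odd s by rewrite oddX.
have sq_ge3 : odd s -> 3 * s <= s ^ 2.
  by move=> s_odd; rewrite leq_mul2r; apply/orP; right; lia.
have q_even : odd (pendant_swaps m) = false.
  by rewrite /pendant_swaps; case: ifP.
have q_le : pendant_swaps m <= 2 by rewrite /pendant_swaps; case: ifP.
have large k : odd s -> 8 * m <= 3 * k -> 8 * m * s <= k * s ^ 2.
  move=> s_odd le_k; apply: leq_trans (leq_mul (leqnn k) (sq_ge3 s_odd)).
  by rewrite mulnCA mulnA leq_mul2r le_k orbT.
have [->|c_gt0] := posnP c.
  rewrite center_sum_first //; case: (boolP (odd s)) => s_odd.
    by rewrite andbF muln1 oddD oddM ?sq_odd s_odd.
  by rewrite oddD !oddM ?sq_odd (negbTE s_odd).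
have [->|c_neq] := eqVneq c (2 * m).
  rewrite center_sum_last // oddD !oddM ?sq_odd.
  case: (boolP (odd s)) => [s_odd _|_]; last by rewrite /= ?andbF.
  by right; apply: leq_trans (leq_addr _ _); apply: large => //; lia.
have [m1|m_ge2] : m = 1 \/ 2 <= m by lia.
  have -> : c = 1 by lia.
  rewrite m1 center_sum_unique // oddD oddM /= => s_odd.
  (* For [s = 3] the sum 21 misses the bound 24, but it is 1 modulo 4. *)
  have [-> | s_ge5] : s = 3 \/ 5 <= s by lia.
    by left.
  right; have : 5 * s <= s ^ 2 by rewrite leq_mul2r s_ge5 orbT.
  by lia.
have [c1|c_neq1] := eqVneq c 1.
  rewrite c1 center_sum_second // oddB; last by lia.
  by rewrite oddD !oddM q_even.
have [->|c_neqP] := eqVneq c (2 * m).-1.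
  rewrite center_sum_penultimate // !oddD !oddM q_even ?sq_odd.
  case: (boolP (odd s)) => [s_odd _|_]; last by rewrite /= ?andbF.
  by right; rewrite -addnA; apply: leq_trans (leq_addr _ _); apply: large => //; lia.
rewrite center_sum_inner //; last by lia.
by rewrite oddD !oddM ?sq_odd oddD oddM.
Qed.

Lemma leaf_center_sum_neq_long s m i l c : 2 <= s -> 0 < m -> i < s ->
  l <= 2 * m -> c <= 2 * m -> leaf_sum s m i l <> center_sum s m c.
Proof.
move=> s_ge2 m_gt0 i_s l_m c_m eq_sum.
have [l_end|l_in] : l \in [:: 0; 2 * m] \/ 0 < l < 2 * m by rewrite !inE; lia.
  have : leaf_sum s m i l <= 2 * s.
    move: l_end; rewrite !inE => /orP[] /eqP ->.
      by rewrite leaf_sum_first //; lia.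
    by rewrite leaf_sum_last //; lia.
  (* A center with two neighboring levels has sum at least [2 * s ^ 2]; an end center has only one,
     but in a block of index at least 1, which gives [3 * s ^ 2]. *)
  suff : 2 * s < center_sum s m c by lia.
  have sq_ge : 2 * s <= s ^ 2 by rewrite leq_mul2r s_ge2 orbT.
  have ge1 l' c' : s ^ 2 <= \sum_(j < s) label s m j l' c'.
    by rewrite sum_label // mulnS -addnA leq_addr.
  rewrite /center_sum; have [->|c_gt0] := posnP c.
    rewrite muln_gt0 m_gt0 /= sum_label // /block.
    have -> : (1 == 2 * m) = false by clear; lia.
    by lia.
  have [c_lt|c_ge] := ltnP c (2 * m).
    by have := ge1 c.+1 c; have := ge1 c.-1 c; lia.
  have -> : c = 2 * m by lia.
  rewrite sum_label // /block.
  have -> : ((2 * m).-1 == 2 * m) = false by lia.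
  have : s ^ 2 * 3 <= s ^ 2 * (2 * (2 * m).-1).+1 by rewrite leq_mul2l; lia.
  by lia.
rewrite leaf_sum_inner // in eq_sum.
have /(center_sum_odd s_ge2 m_gt0 c_m) : odd (center_sum s m c) by lia.
rewrite -eq_sum => -[|]; first by lia.
have : s * l + i < s * (2 * m).
  have : s * l.+1 <= s * (2 * m) by rewrite leq_mul2l; lia.
  by rewrite mulnS; lia.
by lia.
Qed.

(** * Edges of the product and transfer to its vertex sums *)

Section Edges.

Variables s m : nat.
Hypothesis (s_ge2 : 2 <= s) (m_gt0 : 0 < m).

Let G := direct_product (star s) (path_graph (2 * m + 1)).

Lemma low_end_proof (j : 'I_(2 * m)) : j < 2 * m + 1.
Proof. by have := ltn_ord j; lia. Qed.

Lemma high_end_proof (j : 'I_(2 * m)) : j.+1 < 2 * m + 1.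
Proof. by have := ltn_ord j; lia. Qed.

(** The case analysis stays inside the bound proof, so that the value is [b + j] by conversion even
    for a variable [b]. *)
Definition path_end (b : bool) (j : 'I_(2 * m)) : 'I_(2 * m + 1) :=
  Ordinal (if b as b0 return b0 + j < 2 * m + 1 then high_end_proof j
           else low_end_proof j).

(** A star edge and a path edge span two product edges; the boolean tells whether the leaf sits at
    the high end of the path edge. *)
Definition edge_of (t : 'I_s * ('I_(2 * m) * bool)) : {set G} :=
  [set ((Some t.1, path_end t.2.2 t.2.1) : G);
       ((None, path_end (~~ t.2.2) t.2.1) : G)].

Definition edge_label (t : 'I_s * ('I_(2 * m) * bool)) : nat :=
  label s m t.1 (t.2.2 + t.2.1) (~~ t.2.2 + t.2.1).

Lemma path_step_edge (j : 'I_(2 * m)) (b : bool) :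
  path_step m (b + j) (~~ b + j).
Proof. by have := ltn_ord j; rewrite /path_step; case: b => /=; lia. Qed.

Lemma edge_label_inj : injective edge_label.
Proof.
move=> [i [j b]] [i' [j' b']] /label_inj.
case/(_ m_gt0 (ltn_ord i) (ltn_ord i') (path_step_edge _ _)
  (path_step_edge _ _)) => /= /val_inj -> eq_l eq_c.
have eq_b : b = b' by case: b b' eq_l eq_c => [] [] //=; lia.
by rewrite -eq_b in eq_l *; move/addnI/val_inj: eq_l => ->.
Qed.

(** The edge determines its leaf and center, hence its label, and labels are already injective in
    the parameters. *)
Lemma edge_of_inj : injective edge_of.
Proof.
move=> [i [j b]] [i' [j' b']] eq_e; apply: edge_label_inj.
have : ((Some i, path_end b j) : G) \in edge_of (i', (j', b')).
  by rewrite -eq_e !inE eqxx.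
have : ((None, path_end (~~ b) j) : G) \in edge_of (i', (j', b')).
  by rewrite -eq_e !inE eqxx orbT.
rewrite !inE !xpair_eqE /= orbF => /eqP/(congr1 val) /= eq_c.
case/andP=> /eqP[->] /eqP/(congr1 val) /= eq_l.
by rewrite /edge_label /= eq_c eq_l.
Qed.

Lemma edges_edge_of : edges G = [set edge_of t | t : 'I_s * ('I_(2 * m) * bool)].
Proof.
have leaf_edge i (l c : 'I_(2 * m + 1)) : path_adj l c ->
    [set ((Some i, l) : G); ((None, c) : G)] \in
    [set edge_of t | t : 'I_s * ('I_(2 * m) * bool)].
  case/orP=> /eqP lc.
  - have l_lt : l < 2 * m by have := ltn_ord c; lia.
    apply/imsetP; exists (i, (Ordinal l_lt, false)) => //.
    by congr [set (_, _); (_, _)]; apply: val_inj => /=; lia.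
  - have c_lt : c < 2 * m by have := ltn_ord l; lia.
    apply/imsetP; exists (i, (Ordinal c_lt, true)) => //.
    by congr [set (_, _); (_, _)]; apply: val_inj => /=; lia.
apply/setP=> e; apply/edgesP/imsetP => [|[[i [j b]] _ ->]]; last first.
  exists (Some i, path_end b j), (None, path_end (~~ b) j); split=> //.
  by rewrite /adj /= /direct_adj /= /path_adj /=; case: b => /=; lia.
case=> -[[i|] l] [[[i'|] c]] [] /andP[] //= _ lc ->; apply/imsetP.
  exact: leaf_edge.
by rewrite setUC; apply: leaf_edge; rewrite path_adj_sym.
Qed.

Lemma sum_edge_label (P : pred ('I_s * ('I_(2 * m) * bool))) :
  \sum_(t | P t) edge_label t =
    \sum_(i < s) (\sum_(j < 2 * m | P (i, (j, false))) label s m i j j.+1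
      + \sum_(j < 2 * m | P (i, (j, true))) label s m i j.+1 j).
Proof.
rewrite (eq_bigl (fun t => xpredT t.1 && P (t.1, t.2))); last by case.
rewrite -(pair_big_dep xpredT (fun i u => P (i, u)) (fun i u => edge_label (i, u))) /=.
apply: eq_bigr => i _.
rewrite (eq_bigl (fun u => xpredT u.1 && P (i, (u.1, u.2)))); last by case.
rewrite -(pair_big_dep xpredT (fun j b => P (i, (j, b)))
  (fun j b => edge_label (i, (j, b)))) /=.
rewrite [X in _ = X + _]big_mkcond [X in _ = _ + X]big_mkcond -big_split /=.
by apply: eq_bigr => j _; rewrite big_mkcond big_bool /= addnC.
Qed.

Lemma vertex_sum_edge (v : G) :
  \sum_(t | v \in edge_of t) edge_label t =
    if v.1 is Some i then leaf_sum s m i v.2 else center_sum s m v.2.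
Proof.
have low j (k : 'I_(2 * m + 1)) : (k == path_end false j) = (j == k :> nat).
  by rewrite -val_eqE /= eq_sym.
have high j (k : 'I_(2 * m + 1)) : (k == path_end true j) = (j.+1 == k :> nat).
  by rewrite -val_eqE /= eq_sym.
(* Level [k] is the low end of path edge [k] and the high end of path edge [k.-1]; the missing edge
   at an end of the path contributes 0. *)
have sum_low (k : nat) (F : nat -> nat) :
    \sum_(j < 2 * m | j == k :> nat) F j = if k < 2 * m then F k else 0.
  exact: big_ord1_eq.
have sum_high (k : nat) (F : nat -> nat) : k <= 2 * m ->
    \sum_(j < 2 * m | j.+1 == k) F j = if 0 < k then F k.-1 else 0.
  by case: k => [|k] k_m; [rewrite big_pred0|rewrite sum_low k_m].
case: v => v k; have k_m : k <= 2 * m by have := ltn_ord k; lia.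
rewrite sum_edge_label; case: v => [i|] /=.
  rewrite (bigD1 i) //= [X in _ + X]big1 => [|i' neq_i]; last first.
    by rewrite !big_pred0 // => j; rewrite !inE !xpair_eqE /= orbF
      (inj_eq Some_inj) eq_sym (negbTE neq_i).
  rewrite addn0 (eq_bigl (fun j : 'I_(2 * m) => j == k :> nat)); last first.
    by move=> j; rewrite !inE !xpair_eqE /= orbF eqxx low.
  rewrite [X in _ + X](eq_bigl (fun j : 'I_(2 * m) => j.+1 == k :> nat)); last first.
    by move=> j; rewrite !inE !xpair_eqE /= orbF eqxx high.
  rewrite (sum_low k (fun j => label s m i j j.+1)).
  rewrite (sum_high k (fun j => label s m i j.+1 j)) // /leaf_sum.
  by case: (posnP k) => // k_gt0; rewrite prednK.
under eq_bigr => i _.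
  rewrite (eq_bigl (fun j : 'I_(2 * m) => j.+1 == k :> nat)); last first.
    by move=> j; rewrite !inE !xpair_eqE /= high.
  rewrite [X in _ + X](eq_bigl (fun j : 'I_(2 * m) => j == k :> nat)); last first.
    by move=> j; rewrite !inE !xpair_eqE /= low.
  rewrite (sum_high k (fun j => label s m i j j.+1)) //.
  rewrite (sum_low k (fun j => label s m i j.+1 j)).
  over.
rewrite big_split /= /center_sum [RHS]addnC; congr (_ + _).
  by case: (posnP k) => [_|k_gt0]; [rewrite big1|rewrite prednK].
by case: ifP => // _; rewrite big1.
Qed.

Lemma direct_star_path_antimagic : antimagic G.
Proof.
apply: (antimagic_of_param edge_of_inj edges_edge_of edge_label_inj).
  move=> [i [j b]]; rewrite !card_prod !card_ord card_bool.
  have /and3P[l_m _ _] := path_step_edge j b.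
  by have := label_bound (~~ b + j) m_gt0 (ltn_ord i) l_m; rewrite /edge_label /=; lia.
move=> [x k] [x' k']; rewrite /= !vertex_sum_edge /=.
have k_le : k <= 2 * m by have := ltn_ord k; lia.
have k'_le : k' <= 2 * m by have := ltn_ord k'; lia.
case: x x' => [i|] [i'|].
- by case/(leaf_sum_inj m_gt0 (ltn_ord i) (ltn_ord i') k_le k'_le) => /val_inj-> /val_inj->.
- by move/(leaf_center_sum_neq_long s_ge2 m_gt0 (ltn_ord i) k_le k'_le).
- by move/esym/(leaf_center_sum_neq_long s_ge2 m_gt0 (ltn_ord i') k'_le k_le).
move/(center_sum_inj s_ge2 m_gt0 k_le k'_le).
by move/val_inj->.
Qed.

End Edges.

Theorem theorem3p4 (s m : nat) (hs : 2 <= s) (hm : 1 <= m) :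
  antimagic (direct_product (star s) (path_graph (2 * m + 1))).
Proof. exact: direct_star_path_antimagic. Qed.
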